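(* Let $X$ and $Y$ be infinite-dimensional Banach spaces and let $A : X \to Y$ be a bounded linear operator such that the operator equation $Ax = y$ is ill-posed. Then the equation is ill-posed of type II if and only if $A$ is strictly singular.
   Context: $\mathcal{R}(A)$ and $\mathcal{N}(A)$ denote the range and null-space of $A$. A closed subspace $N$ of a Banach space (or normed space) $Z$ is called complemented in $Z$ if there is a closed subspace $U$ of $Z$ with $Z = N \oplus U$ (direct sum). Let $A : X \to Y$ be a bounded linear operator between infinite-dimensional Banach spaces. The operator equation $Ax = y$ ($x \in X$, $y \in Y$) is called well-posed if $\mathcal{R}(A)$ is a closed subset of $Y$ and, moreover, $\mathcal{N}(A)$ is complemented in $X$; otherwise it is called ill-posed. In the ill-posed case, it is called ill-posed of type I if $\mathcal{R}(A)$ contains an infinite-dimensional closed subspace $M$ of $Y$ such that $\mathcal{N}(A)$ is complemented in $A^{-1}[M]$, where $A^{-1}[M]$ is the inverse image of $M$ under $A$. Otherwise the ill-posed equation is called ill-posed of type II. A bounded linear operator $A : X \to Y$ between Banach spaces is called strictly singular if, for every infinite-dimensional subspace $M$ of $X$, the restriction of $A$ to $M$ is not an isomorphism (linear homeomorphism) onto its image. *)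

(* Defs.v *)
From HB Require Import structures.
From mathcomp Require Import all_boot all_order all_algebra.
From mathcomp Require Import complex.
From mathcomp Require Import boolp classical_sets functions reals topology.
From mathcomp Require Import normedtype.

Set Implicit Arguments.
Unset Strict Implicit.
Unset Printing Implicit Defensive.

Import Order.TTheory GRing.Theory Num.Theory.
Import numFieldNormedType.Exports.

Local Open Scope classical_set_scope.
Local Open Scope ring_scope.
Local Open Scope complex_scope.

(* [completeNormedModType K] makes sense over any [numFieldType]; Banach spaces
   are those whose scalars are the real or the complex numbers. *)
Definition real_or_complex (K : numFieldType) : Prop :=
  exists R : realType, K = R :> numFieldType \/ K = R[i] :> numFieldType.

Section Subspaces.
Context {K : numFieldType} {V : normedModType K}.
Implicit Types M N U Z : set V.

Definition linear_subspace M : Prop := submod_closed (mem M).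

Definition finite_dimensional M : Prop :=
  exists (n : nat) (e : 'I_n -> V), (forall i, M (e i)) /\
    forall x, M x -> exists c : 'I_n -> K, x = \sum_i c i *: e i.

Definition infinite_dimensional M : Prop := ~ finite_dimensional M.

(* Closedness is relative to the topology that [Z] inherits from [V]. *)
Definition closed_subspace_of Z N : Prop :=
  [/\ linear_subspace N, N `<=` Z & closed (N : set (subspace Z))].

Definition direct_sum Z N U : Prop :=
  Z = [set x + u | x in N & u in U] /\ N `&` U = [set 0].

Definition complemented Z N : Prop :=
  closed_subspace_of Z N /\
  exists U, closed_subspace_of Z U /\ direct_sum Z N U.

End Subspaces.

Section Operators.
Context {K : numFieldType} {X Y : completeNormedModType K}.
Implicit Type A : {linear X -> Y}.

Definition null_space A : set X := A @^-1` [set 0].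

Definition well_posed A : Prop :=
  closed (range A) /\ complemented [set: X] (null_space A).

Definition ill_posed A : Prop := ~ well_posed A.

Definition ill_posed_type_I A : Prop :=
  ill_posed A /\
  exists M : set Y,
    [/\ M `<=` range A, linear_subspace M, closed M, infinite_dimensional M
      & complemented (A @^-1` M) (null_space A)].

Definition ill_posed_type_II A : Prop := ill_posed A /\ ~ ill_posed_type_I A.

(* [B] is the inverse of the restriction of [A] to [M]; its linearity on
   [A @` M] is automatic. *)
Definition isomorphism_onto_image A (M : set X) : Prop :=
  exists B : Y -> X,
    [/\ (forall x, M x -> B (A x) = x), {within M, continuous A}
      & {within A @` M, continuous B}].

Definition strictly_singular A : Prop :=
  forall M : set X, linear_subspace M -> infinite_dimensional M ->
    ~ isomorphism_onto_image A M.

End Operators.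

(* Main.v *)
Require Import Defs.
From HB Require Import structures.
From mathcomp Require Import all_boot all_order all_algebra.
From mathcomp Require Import boolp classical_sets functions reals topology.
From mathcomp Require Import normedtype.
From mathcomp Require Import complex ring.
Import numFieldNormedType.Exports.
Import Order.TTheory GRing.Theory Num.Theory.
Local Open Scope classical_set_scope.
Local Open Scope ring_scope.

(** Since the equation is ill-posed by assumption, the claim is that it is of
    type I exactly when [A] restricts to an isomorphism on some
    infinite-dimensional subspace [M].  The bridge is [bounded_below A M]: there
    is [d > 0] with [d * |x| <= |A x|] on [M].  For a bounded [A] this is the
    same as being an isomorphism of [M] onto its image
    ([isomorphism_bounded_below], [bounded_below_isomorphism]).

    Suppose that [A] is bounded below on [M].  The estimate passes to the
    closure of [M] ([bounded_below_closure]), and then completeness of [X]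
    makes [A (closure M)] closed ([bounded_below_closed_image]).  As [A] is
    injective on [closure M], this image is infinite-dimensional, and
    [closure M] is a closed complement of the null-space in its inverse image
    ([bounded_below_complemented]).  So [A (closure M)] witnesses type I.

    Conversely, let [M] witness type I and let [U] be a closed complement of
    the null-space in the inverse image of [M].  Then [A] is a bounded bijection
    between the Banach spaces [U] and [M], hence bounded below on [U] by the open
    mapping theorem, and [U] is infinite-dimensional because [M] is.

    The open mapping theorem is proved for a closed subspace [U] with closed
    image: a Baire argument shows that small vectors of [A U] are approximated
    by images of a fixed ball of [U] ([dense_image_of_ball]), and a series of
    corrections, each halving the error, turns approximations into solutions
    ([open_mapping]).  Every limit in the file comes from one convergence
    criterion, [halving_cvg], for sequences whose steps are dominated by a
    sequence that at least halves each time. *)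

Set Implicit Arguments.
Unset Strict Implicit.

(** * Convergence of halving sequences *)

(** The only property of real or complex scalars used below is that natural
    numbers bound every nonnegative scalar; for complex scalars, a nonnegative
    one is real. *)
Lemma real_or_complex_archi (K : numFieldType) (x : K) :
  real_or_complex K -> 0 <= x -> exists n : nat, x <= n%:R.
Proof.
move=> [R [E|E]]; move: x; rewrite E => x x0 {K E}.
  by exists (Num.bound x); exact/ltW/archi_boundP.
move: x0; rewrite lecE /= => /andP[/eqP x0 rx0].
exists (Num.bound (complex.Re x)).
have -> : (Num.bound (complex.Re x))%:R =
          ((Num.bound (complex.Re x))%:R)%:C%C :> R[i].
  by rewrite rmorph_nat.
by rewrite lecE /= x0 eqxx /= ltW // archi_boundP.
Qed.

Lemma dyadic_lt (K : numFieldType) (D e : K) : real_or_complex K ->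
  0 <= D -> 0 < e -> exists n : nat, D / 2 ^+ n < e.
Proof.
move=> hK D0 e0.
have [n hn] := real_or_complex_archi hK (divr_ge0 D0 (ltW e0)).
exists n; rewrite ltr_pdivrMr ?exprn_gt0 // mulrC -ltr_pdivrMr //.
apply: le_lt_trans hn _.
by rewrite -natrX ltr_nat ltn_expl.
Qed.

Lemma le0_dyadic (K : numFieldType) (z D : K) : real_or_complex K ->
  0 <= D -> (forall n : nat, z <= D / 2 ^+ n) -> z <= 0.
Proof.
move=> hK D0 hz; apply/ler_addgt0Pr => e e0; rewrite add0r.
have [n hn] := dyadic_lt hK D0 e0.
exact: le_trans (hz n) (ltW hn).
Qed.

(** The hypotheses give
    [|s (n + k) - s n| <= rho n - rho (n + k)], a telescoping bound; this is why
    the distance from [s n] to the limit is at most [rho n], with no extra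
    factor.  That sharp constant is what makes the nested balls in the Baire
    argument contain the limit. *)
Lemma halving_cvg (K : numFieldType) (V : completeNormedModType K)
    (s : nat -> V) (rho : nat -> K) : real_or_complex K ->
  (forall n, `|s n.+1 - s n| <= rho n / 2) ->
  (forall n, rho n.+1 <= rho n / 2) ->
  exists l, s @ \oo --> l /\ forall n, `|l - s n| <= rho n.
Proof.
move=> hK hs hrho.
have rho0 n : 0 <= rho n.
  by have := le_trans (normr_ge0 _) (hs n); rewrite pmulr_lge0 // invr_gt0.
have tele n k : `|s (n + k)%N - s n| <= rho n - rho (n + k)%N.
  elim: k => [|k IH]; first by rewrite addn0 !subrr normr0.
  rewrite addnS -(subrKA (s (n + k)%N)).
  apply: le_trans (ler_normD _ _) _.
  apply: le_trans (lerD (hs _) IH) _.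
  have -> : rho (n + k)%N / 2 + (rho n - rho (n + k)%N) =
            rho n - rho (n + k)%N / 2 by field.
  by rewrite lerD2l lerN2.
have tail n m : (n <= m)%N -> `|s m - s n| <= rho n.
  move=> /subnKC <-; apply: le_trans (tele _ _) _.
  by rewrite lerBlDr lerDl.
have geo n : rho n <= rho 0%N / 2 ^+ n.
  elim: n => [|n IH]; first by rewrite expr0 divr1.
  apply: le_trans (hrho n) _.
  by rewrite exprSr invfM mulrA ler_pM2r // invr_gt0.
have cs : cauchy (s @ \oo).
  apply: cauchy_exP => e e0.
  have [N hN] := dyadic_lt hK (rho0 0%N) e0.
  exists (s N); exists N => // m /= Nm.
  rewrite -ball_normE /= distrC.
  exact: le_lt_trans (tail _ _ Nm) (le_lt_trans (geo N) hN).
have /cvg_ex[l sl] : cvg (s @ \oo) by apply/cauchy_cvgP.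
exists l; split => // n; apply/ler_addgt0Pr => e e0.
move/cvgrPdist_le/(_ e e0) : (sl) => [N _ hN].
pose m := maxn N n.
rewrite -(subrKA (s m)) addrC; apply: le_trans (ler_normD _ _) _.
by rewrite lerD // ?tail ?hN //= ?leq_maxl ?leq_maxr.
Qed.

(** * Linear subspaces, closures and finite dimension *)

Section LinearSubspaces.
Context {K : numFieldType} {V : normedModType K}.
Implicit Types M N : set V.

Lemma linear_subspaceP M : linear_subspace M <->
  M 0 /\ forall (a : K) u v, M u -> M v -> M (a *: u + v).
Proof.
split=> [[M0 MD]|[M0 MD]].
  split; first exact/set_mem.
  by move=> a u v Mu Mv; apply/set_mem/MD; apply/mem_set.
split; first exact/mem_set.
by move=> a u v /set_mem Mu /set_mem Mv; apply/mem_set/MD.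
Qed.

Lemma linear_subspace0 M : linear_subspace M -> M 0.
Proof. by case/linear_subspaceP. Qed.

Lemma linear_subspaceZ M (a : K) u : linear_subspace M -> M u -> M (a *: u).
Proof.
by case/linear_subspaceP => M0 h Mu; rewrite -[X in M X]addr0; apply: h.
Qed.

Lemma linear_subspaceD M u v : linear_subspace M -> M u -> M v -> M (u + v).
Proof.
by case/linear_subspaceP => _ h Mu; rewrite -[X in M (X + _)]scale1r; apply: h.
Qed.

Lemma linear_subspaceB M u v : linear_subspace M -> M u -> M v -> M (u - v).
Proof.
move=> hM Mu Mv; apply: linear_subspaceD => //.
by rewrite -scaleN1r; exact: linear_subspaceZ.
Qed.

Lemma closure_norm M x :
  closure M x <-> forall e : K, 0 < e -> exists2 u, M u & `|x - u| < e.
Proof.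
split=> [Mx e e0|h B].
  have [u [Mu]] := Mx _ (nbhsx_ballx x e e0).
  by rewrite -ball_normE /= => xu; exists u.
rewrite -nbhs_ballE => -[e /= e0 eB]; have [u Mu xu] := h e e0.
by exists u; split=> //; apply: eB; rewrite -ball_normE.
Qed.

Lemma linear_subspace_closure M : linear_subspace M -> linear_subspace (closure M).
Proof.
move=> hM; apply/linear_subspaceP; split.
  by apply: subset_closure; apply: linear_subspace0.
move=> a u v /(closure_norm M u) hu /(closure_norm M v) hv.
apply/closure_norm => e e0.
have a0 : 0 < `|a| + 1 by rewrite ltr_pwDr.
have [u' Mu' uu'] := hu (e / 2 / (`|a| + 1)) ltac:(by rewrite !divr_gt0).
have [v' Mv' vv'] := hv (e / 2) ltac:(by rewrite divr_gt0).
exists (a *: u' + v').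
  by apply: linear_subspaceD => //; exact: linear_subspaceZ.
rewrite opprD addrACA -scalerBr (splitr e).
apply: le_lt_trans (ler_normD _ _) _; apply: ler_ltD => //.
rewrite normrZ; apply: (@le_trans _ _ ((`|a| + 1) * `|u - u'|)).
  by rewrite ler_wpM2r // lerDl.
by rewrite mulrC -ler_pdivlMr // ltW.
Qed.

(** [finite_dimensional M] asks for spanning vectors inside [M]; here the
    vectors [e i] may lie outside.  By induction on their number: the members of
    [M] that avoid [e ord0] form a subspace [M0] covered by the induction
    hypothesis, and one vector [v] of [M] outside [M0] suffices to cancel the
    [e ord0] component of every other member. *)
Lemma finite_dimensional_sub M (n : nat) (e : 'I_n -> V) :
  linear_subspace M ->
  (forall x, M x -> exists c : 'I_n -> K, x = \sum_i c i *: e i) ->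
  finite_dimensional M.
Proof.
elim: n e M => [|n IH] e M hM he.
  by exists 0%N, e; split => // -[].
pose e' i := e (lift ord0 i).
pose M0 : set V := [set x | M x /\ exists c : 'I_n -> K, x = \sum_i c i *: e' i].
have hM0 : linear_subspace M0.
  apply/linear_subspaceP; split.
    split; first exact: linear_subspace0.
    by exists (fun=> 0); rewrite big1 // => i _; rewrite scale0r.
  move=> a u v [Mu [c uE]] [Mv [d vE]]; split.
    by apply: linear_subspaceD => //; apply: linear_subspaceZ.
  exists (fun i => a * c i + d i); rewrite uE vE scaler_sumr -big_split /=.
  by apply: eq_bigr => i _; rewrite scalerDl scalerA.
have [m [f [Mf hf]]] := IH e' M0 hM0 (fun x h => proj2 h).
have [MM0|] := pselect (M `<=` M0).
  exists m, f; split=> [i|x Mx]; first by case: (Mf i).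
  by apply: hf; apply: MM0.
move=> /existsNP[v /not_implyP[Mv M0v]].
have [c vE] := he v Mv.
have c0 : c ord0 != 0.
  apply/eqP => c0; apply: M0v; split => //.
  exists (fun i => c (lift ord0 i)).
  by rewrite {1}vE big_ord_recl c0 scale0r add0r.
(* [v] comes first, followed by the vectors that span [M0]. *)
exists m.+1, (fun i => oapp f v (unlift ord0 i)); split.
  by move=> i; case: unliftP => [j _|_] //=; case: (Mf j).
move=> x Mx; have [d xE] := he x Mx.
pose t := d ord0 / c ord0.
have /hf[g gE] : M0 (x - t *: v).
  split; first by apply: linear_subspaceB => //; apply: linear_subspaceZ.
  exists (fun i => d (lift ord0 i) - t * c (lift ord0 i)).
  rewrite {1}xE {1}vE !big_ord_recl scalerDr scalerA divfK // opprD addrACA.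
  rewrite subrr add0r scaler_sumr -sumrB.
  by apply: eq_bigr => i _; rewrite scalerBl scalerA.
exists (fun i => oapp g t (unlift ord0 i)).
rewrite big_ord_recl unlift_none /=.
under eq_bigr => i _ do rewrite liftK /=.
by rewrite -gE addrC subrK.
Qed.

Lemma finite_dimensional_subset M N : linear_subspace M -> M `<=` N ->
  finite_dimensional N -> finite_dimensional M.
Proof.
move=> hM MN [n [e [_ he]]]; apply: (finite_dimensional_sub hM (e := e)).
by move=> x /MN/he.
Qed.

End LinearSubspaces.

Section LinearImages.
Context {K : numFieldType} {V W : normedModType K}.
Implicit Types (A : {linear V -> W}) (M : set V).

Lemma linear_subspace_image A M : linear_subspace M -> linear_subspace (A @` M).
Proof.
move=> hM; apply/linear_subspaceP; split.
  by exists 0; [exact: linear_subspace0 | rewrite linear0].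
move=> a _ _ [u Mu <-] [v Mv <-]; exists (a *: u + v); last by rewrite linearP.
by apply: linear_subspaceD => //; exact: linear_subspaceZ.
Qed.

Lemma finite_dimensional_image A M :
  finite_dimensional M -> finite_dimensional (A @` M).
Proof.
move=> [n [e [Me he]]]; exists n, (A \o e); split=> [i|_ [x Mx <-]].
  by exists (e i).
have [c ->] := he x Mx; exists c.
by rewrite linear_sum; apply: eq_bigr => i _; rewrite linearZ.
Qed.

Lemma finite_dimensional_inj A M : linear_subspace M ->
  (forall x, M x -> A x = 0 -> x = 0) ->
  finite_dimensional (A @` M) -> finite_dimensional M.
Proof.
move=> hM injA [n [e [Me he]]].
have /choice[f hf] : forall i, exists x, M x /\ A x = e i.
  by move=> i; have [x Mx Ax] := Me i; exists x.
exists n, f; split=> [i|x Mx]; first by case: (hf i).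
have [c AxE] := he (A x) (ex_intro2 _ _ x Mx erefl).
exists c; apply/eqP; rewrite -subr_eq0; apply/eqP/injA.
  apply: linear_subspaceB => //.
  apply: (big_ind M); first exact: linear_subspace0.
    by move=> u v; apply: linear_subspaceD.
  by move=> i _; apply: linear_subspaceZ => //; case: (hf i).
rewrite linearB linear_sum AxE; apply/eqP; rewrite subr_eq0; apply/eqP.
by apply: eq_bigr => i _; rewrite linearZ; case: (hf i) => _ ->.
Qed.

Lemma linear_bound A : bounded_near A (nbhs (0 : V)) ->
  exists2 C : K, 0 < C & forall x, `|A x| <= C * `|x|.
Proof. by move=> /linear_boundedP/pinfty_ex_gt0. Qed.

End LinearImages.

(** * The open mapping theorem *)

Section DenseImage.
Context {K : numFieldType} {X : normedModType K} {Y : completeNormedModType K}.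
Implicit Types (A : {linear X -> Y}) (U : set X).

(** One step of the Baire argument.  Let [D] be the image of the ball of radius
    [n] in [U], and let [y] be a small vector of [A U] at positive distance from
    [D].  Then [s + y] or [s - y] is at positive distance from [D]: if both were
    close to [D], then so would be half their difference, which is [y], because
    [D] is convex and symmetric.  Any point [s] can thus be moved off [D]
    directly, without first centring a ball at the origin. *)
Lemma move_off_image_of_ball A U (s : Y) (n : nat) (rho : K) :
  linear_subspace U -> 0 < rho -> (A @` U) s ->
  (forall r : K, 0 < r -> exists y, [/\ (A @` U) y, `|y| < r &
     exists2 e : K, 0 < e &
       forall u, U u -> `|u| <= n%:R -> ~ `|y - A u| < e]) ->
  exists s' rho', [/\ (A @` U) s', 0 < rho', `|s' - s| <= rho / 2,
    rho' <= rho / 2 & forall u, U u -> `|u| <= n%:R -> ~ `|s' - A u| <= rho'].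
Proof.
move=> hU rho0 Ms /(_ (rho / 2)); rewrite divr_gt0// => -[//|y [My yr [e e0 he]]].
have hM := linear_subspace_image A hU.
(* Norms are real scalars, but the order of the field need not be total. *)
have [rho' [rho'0 rho'r rho'e]] : exists r : K, [/\ 0 < r, r <= rho / 2 & r < e].
  have [h|h] := real_leP (gtr0_real e0) (gtr0_real rho0).
    exists (e / 2); rewrite divr_gt0 // ler_pM2r ?invr_gt0 //; split=> //.
    by rewrite gtr_pMr // invf_lt1 // ltr1n.
  exists (rho / 2); rewrite divr_gt0 //; split=> //; apply: lt_trans h.
  by rewrite gtr_pMr // invf_lt1 // ltr1n.
have [hp|/existsNP[u1 /not_implyP[Uu1 /not_implyP[nu1 /contrapT yu1]]]] :=
  pselect (forall u, U u -> `|u| <= n%:R -> ~ `|s + y - A u| <= rho').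
  exists (s + y), rho'; split => //; first exact: linear_subspaceD.
  by rewrite addrC addKr ltW.
have [hm|/existsNP[u2 /not_implyP[Uu2 /not_implyP[nu2 /contrapT yu2]]]] :=
  pselect (forall u, U u -> `|u| <= n%:R -> ~ `|s - y - A u| <= rho').
  exists (s - y), rho'; split => //; first exact: linear_subspaceB.
  by rewrite addrAC subrr add0r normrN ltW.
exfalso; apply: (he (2^-1 *: (u1 - u2))).
- by apply: linear_subspaceZ => //; apply: linear_subspaceB.
- rewrite normrZ ger0_norm ?invr_ge0 // mulrC ler_pdivrMr //.
  by apply: le_trans (ler_normB _ _) _; rewrite mulrDr mulr1 lerD.
have -> : y - A (2^-1 *: (u1 - u2)) = 2^-1 *: ((s + y - A u1) - (s - y - A u2)).
  rewrite linearZ linearB /=.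
  have {1}-> : y = 2^-1 *: (y + y).
    rewrite -[y + y]/(y *+ 2) -(scaler_nat 2 y) scalerA mulVf ?scale1r //.
    by rewrite pnatr_eq0.
  rewrite -scalerBr; congr (_ *: _).
  rewrite !opprB (addrC s y) (addrAC y s) -[RHS]addrA.
  rewrite [A u2 + (y - s)]addrA (addrCA s).
  by rewrite subrr addr0 (addrC _ y) addrACA (addrC (- _)).
rewrite normrZ ger0_norm ?invr_ge0 // mulrC ltr_pdivrMr //.
apply: le_lt_trans (ler_normB _ _) _; rewrite mulrDr mulr1.
by apply: ltrD; apply: le_lt_trans rho'e.
Qed.

(** If every [n] failed, [move_off_image_of_ball] could be applied to each [n]
    in turn, giving nested balls such that the one chosen at step [n] avoids the
    image of the ball of radius [n] of [U].  Their common point belongs to the closed set [A U] but is the image of no vector of [U],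
    since a preimage would have norm at most some natural number. *)
Lemma dense_image_of_ball A U : real_or_complex K ->
  linear_subspace U -> closed (A @` U) ->
  exists n : nat, exists2 r : K, 0 < r & forall y, (A @` U) y -> `|y| < r ->
    forall e : K, 0 < e -> exists u, [/\ U u, `|u| <= n%:R & `|y - A u| < e].
Proof.
move=> hK hU clM; apply: contrapT => /forallNP hn.
have {}hn n (r : K) : 0 < r -> exists y, [/\ (A @` U) y, `|y| < r &
     exists2 e : K, 0 < e & forall u, U u -> `|u| <= n%:R -> ~ `|y - A u| < e].
  move=> r0; apply: contrapT => H; apply: (hn n); exists r => // y My yr e e0.
  apply: contrapT => Hu; apply: H; exists y; split => //; exists e => // u Uu un yu.
  by apply: Hu; exists u.
pose good (n : nat) (p q : Y * K) := [/\ (A @` U) q.1, 0 < q.2,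
  `|q.1 - p.1| <= p.2 / 2, q.2 <= p.2 / 2 &
  forall u, U u -> `|u| <= n%:R -> ~ `|q.1 - A u| <= q.2].
have /choice[step hstep] : forall np : nat * (Y * K), exists q,
    (A @` U) np.2.1 -> 0 < np.2.2 -> good np.1 np.2 q.
  move=> [n [s rho]] /=; have [[Ms rho0]|h] := pselect ((A @` U) s /\ 0 < rho).
    have [s' [rho' h]] := move_off_image_of_ball hU rho0 Ms (hn n).
    by exists (s', rho').
  by exists (s, rho) => Ms rho0; case: h.
(* Centres and radii of the nested balls. *)
pose p := fix p n := if n is m.+1 then step (m, p m) else (0 : Y, 1 : K).
have hp n : (A @` U) (p n).1 /\ 0 < (p n).2.
  elim: n => [|n [Mp p0]] /=.
    by split=> //; exact: linear_subspace0 (linear_subspace_image A hU).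
  by have [] := hstep (n, p n) Mp p0.
have {}hstep n : good n (p n) (p n.+1).
  by have [Mp p0] := hp n; exact: hstep (n, p n) Mp p0.
have [l [pl hl]] : exists l, (fst \o p) @ \oo --> l /\
    forall n, `|l - (p n).1| <= (p n).2.
  by apply: (halving_cvg hK (s := fst \o p) (rho := snd \o p)) => n;
    case: (hstep n).
have [u Uu Au] : (A @` U) l.
  by apply: (closed_cvg _ clM _ _ pl); apply: nearW => n; case: (hp n).
have [n un] := real_or_complex_archi hK (normr_ge0 u).
case: (hstep n) => _ _ _ _ /(_ u Uu un); apply.
by rewrite Au distrC.
Qed.

(** The homogeneous form of [dense_image_of_ball]: [y] is rescaled to norm
    [r / 2] and approximated up to [r / 4], so the error is half of [y]. *)
Lemma approximate_preimage A U : real_or_complex K ->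
  linear_subspace U -> closed (A @` U) ->
  exists2 c : K, 0 <= c & forall y, (A @` U) y ->
    exists u, [/\ U u, `|u| <= c * `|y| & `|y - A u| <= `|y| / 2].
Proof.
move=> hK hU clM; have [n [r r0 hr]] := dense_image_of_ball hK hU clM.
have hM := linear_subspace_image A hU.
exists (n%:R * 2 / r) => [|y My]; first by rewrite divr_ge0 ?mulr_ge0 ?ler0n // ltW.
have [->|y0] := eqVneq y 0.
  exists 0; split; first exact: linear_subspace0.
    by rewrite !normr0 mulr0.
  by rewrite linear0 subr0 !normr0 mul0r.
have ny0 : 0 < `|y| by rewrite normr_gt0.
pose t := r / 2 / `|y|.
have t0 : 0 < t by rewrite !divr_gt0.
have nt (V : normedModType K) (v : V) : `|t^-1 *: v| = `|v| / t.
  by rewrite normrZ gtr0_norm ?invr_gt0 // mulrC.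
have tyr : `|t *: y| < r.
  rewrite normrZ gtr0_norm // /t divfK ?gt_eqF //.
  by rewrite gtr_pMr // invf_lt1 // ltr1n.
have [u [Uu un yu]] :=
  hr (t *: y) (linear_subspaceZ t hM My) tyr (r / 2 / 2)
    ltac:(by rewrite !divr_gt0).
exists (t^-1 *: u); split; first exact: linear_subspaceZ.
  rewrite nt ler_pdivrMr //.
  suff -> : n%:R * 2 / r * `|y| * t = n%:R by [].
  by rewrite /t; field; rewrite !gt_eqF.
have -> : y - A (t^-1 *: u) = t^-1 *: (t *: y - A u).
  by rewrite linearZ scalerBr scalerA mulVf ?scale1r // gt_eqF.
rewrite nt ler_pdivrMr //.
suff -> : `|y| / 2 * t = r / 2 / 2 by exact: ltW.
by rewrite /t; field; rewrite !gt_eqF.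
Qed.

End DenseImage.

(** The approximate preimages of [approximate_preimage] are applied again to the
    error they leave; the errors decay like [2^-n], so the corrections add up to
    an exact preimage in [U], whose norm is at most twice the bound on the first
    correction. *)
Theorem open_mapping (K : numFieldType) (X Y : completeNormedModType K)
    (A : {linear X -> Y}) (U : set X) : real_or_complex K ->
  bounded_near A (nbhs (0 : X)) ->
  linear_subspace U -> closed U -> closed (A @` U) ->
  exists2 C : K, 0 <= C & forall y, (A @` U) y ->
    exists u, [/\ U u, A u = y & `|u| <= C * `|y|].
Proof.
move=> hK hA hU clU clM; have [c c0 hc] := approximate_preimage hK hU clM.
have [D D0 hD] := linear_bound hA.
have hM := linear_subspace_image A hU.
exists (c * 2) => [|y My]; first by rewrite mulr_ge0.
have /choice[g hg] : forall z, exists u, (A @` U) z ->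
    [/\ U u, `|u| <= c * `|z| & `|z - A u| <= `|z| / 2].
  move=> z; have [/hc[u hu]|Mz] := pselect ((A @` U) z); first by exists u.
  by exists 0.
pose s := fix s n := if n is m.+1 then s m + g (y - A (s m)) else 0 : X.
have Us n : U (s n).
  elim: n => [|n IH] /=; first exact: linear_subspace0.
  apply: linear_subspaceD => //.
  by have [] // := hg (y - A (s n)); apply: linear_subspaceB => //; exists (s n).
have hs n := hg (y - A (s n))
  (linear_subspaceB hM My (ex_intro2 _ _ (s n) (Us n) erefl)).
(* [y - A (s n)] is the error left after [n] corrections. *)
have res n : `|y - A (s n)| <= `|y| / 2 ^+ n.
  elim: n => [|n IH]; first by rewrite /= linear0 subr0 expr0 divr1.
  rewrite /= linearD opprD addrA; case: (hs n) => _ _ /le_trans; apply.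
  by rewrite exprSr invfM mulrA ler_pM2r // invr_gt0.
pose rho n := c * 2 * `|y| / 2 ^+ n.
have [l [sl hl]] : exists l, s @ \oo --> l /\ forall n, `|l - s n| <= rho n.
  apply: halving_cvg => // n; last by rewrite /rho exprSr invfM mulrA.
  rewrite /= addrC addKr; case: (hs n) => _ /le_trans + _; apply.
  apply: le_trans (ler_wpM2l c0 (res n)) _.
  rewrite le_eqVlt; apply/orP; left; apply/eqP.
  by rewrite /rho; field; rewrite expf_neq0 ?pnatr_eq0.
exists l; split.
- by apply: (closed_cvg _ clU _ _ sl); apply: nearW.
- apply/eqP; rewrite eq_sym -subr_eq0 -normr_le0.
  apply: (le0_dyadic (D := `|y| + D * (c * 2 * `|y|)) hK) => [|n].
    by rewrite addr_ge0 // !mulr_ge0 // ltW.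
  rewrite -(subrKA (A (s n))) mulrDl; apply: le_trans (ler_normD _ _) _.
  rewrite lerD // -linearB; apply: le_trans (hD _) _.
  by rewrite -mulrA ler_pM2l // distrC.
by have := hl 0%N; rewrite /rho /= subr0 expr0 divr1.
Qed.

(** * Operators bounded below on a subspace *)

Section BoundedBelow.
Context {K : numFieldType} {X Y : normedModType K}.
Implicit Types (A : {linear X -> Y}) (M : set X).

Definition bounded_below A M : Prop :=
  exists2 d : K, 0 < d & forall x, M x -> d * `|x| <= `|A x|.

Lemma bounded_below_eq0 A M x : bounded_below A M -> M x -> A x = 0 -> x = 0.
Proof.
move=> [d d0 hd] Mx Ax0; apply/eqP; rewrite -normr_le0 -(pmulr_rle0 _ d0).
by apply: le_trans (hd x Mx) _; rewrite Ax0 normr0.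
Qed.

Lemma bounded_below_closure A M : bounded_near A (nbhs (0 : X)) ->
  bounded_below A M -> bounded_below A (closure M).
Proof.
move=> /linear_bound[C C0 hC] [d d0 hd]; exists d => // x /closure_norm hx.
apply/ler_addgt0Pr => e e0.
have [u Mu xu] := hx (e / (d + C)) ltac:(by rewrite divr_gt0 ?addr_gt0).
rewrite -{1}(subrK u x); apply: (@le_trans _ _ (d * `|x - u| + d * `|u|)).
  by rewrite -mulrDr ler_pM2l // ler_normD.
have Au : `|A u| <= `|A x| + C * `|x - u|.
  rewrite -{1}(subKr x u) linearB; apply: le_trans (ler_normB _ _) _.
  by rewrite lerD2l.
apply: le_trans (lerD (lexx _) (le_trans (hd u Mu) Au)) _.
rewrite addrCA lerD2l -mulrDl mulrC -ler_pdivlMr ?addr_gt0 //.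
exact: ltW.
Qed.

End BoundedBelow.

Section BoundedBelowBanach.
Context {K : numFieldType} {X Y : completeNormedModType K}.
Implicit Types (A : {linear X -> Y}) (M : set X).

(** Continuity at [0] of the inverse gives [d > 0] such that [|A u| < d]
    implies [|u| < 1]; a unit vector [u] of [M] then has [d <= |A u|]. *)
Lemma isomorphism_bounded_below A M : linear_subspace M ->
  isomorphism_onto_image A M -> bounded_below A M.
Proof.
move=> hM [B [BA _ cB]].
have M0 := linear_subspace0 hM.
have B0 : B 0 = 0 by rewrite -(linear0 A) BA.
have AM0 : (A @` M) 0 by exists 0; rewrite ?linear0.
move/subspace_continuousP/(_ 0 AM0)/cvgrPdist_lt/(_ 1 ltr01) : cB.
rewrite near_withinE => /nbhs_ballP[d /= d0 hd].
exists d => // x Mx; have [->|x0] := eqVneq x 0; first by rewrite normr0 mulr0.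
have nx0 : 0 < `|x| by rewrite normr_gt0.
pose u := `|x|^-1 *: x.
have Mu : M u by exact: linear_subspaceZ.
have nu (V : normedModType K) (w : V) : `| `|x|^-1 *: w| = `|w| / `|x|.
  by rewrite normrZ gtr0_norm ?invr_gt0 // mulrC.
rewrite -ler_pdivlMr // -nu -linearZ.
rewrite real_leNgt ?(gtr0_real d0) ?normr_real //; apply/negP => Aud.
have AMu : (A @` M) (A u) by exists u.
have dAu : ball (0 : Y) d (A u) by rewrite -ball_normE /= sub0r normrN.
have {hd}: `|B 0 - B (A u)| < 1 := hd (A u) dAu AMu.
by rewrite B0 BA // sub0r normrN nu divff ?ltxx // gt_eqF.
Qed.

Lemma bounded_below_isomorphism A M : linear_subspace M ->
  continuous A -> bounded_below A M -> isomorphism_onto_image A M.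
Proof.
move=> hM cA [d d0 hd].
have /choice[B hB] : forall y, exists x, (A @` M) y -> M x /\ A x = y.
  move=> y; have [[x Mx Ax]|h] := pselect ((A @` M) y); first by exists x.
  by exists 0.
have Bd y z : (A @` M) y -> (A @` M) z -> d * `|B y - B z| <= `|y - z|.
  move=> /hB[My Ay] /hB[Mz Az]; rewrite -{2}Ay -{2}Az -linearB.
  by apply: hd; exact: linear_subspaceB.
exists B; split.
- move=> x Mx; have [MB AB] := hB (A x) (ex_intro2 _ _ x Mx erefl).
  apply/eqP; rewrite -subr_eq0; apply/eqP.
  apply: (bounded_below_eq0 (A := A) (M := M)); first by exists d.
    exact: linear_subspaceB.
  by rewrite linearB AB subrr.
- exact: continuous_subspaceT.
- apply/subspace_continuousP => y My; apply/cvgrPdist_lt => e e0.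
  have := nbhsx_ballx y (d * e) (mulr_gt0 d0 e0).
  rewrite -ball_normE; apply: filterS => z /= yz Mz.
  by rewrite -(ltr_pM2l d0); exact: le_lt_trans (Bd _ _ My Mz) yz.
Qed.

(** If [A (s n)] tends to [y] at the rate [2^-n], then the lower bound transfers
    this rate to [s], which therefore converges, and its limit is mapped to
    [y]. *)
Lemma bounded_below_closed_image A M : real_or_complex K ->
  bounded_near A (nbhs (0 : X)) -> linear_subspace M -> closed M ->
  bounded_below A M -> closed (A @` M).
Proof.
move=> hK /linear_bound[C C0 hC] hM clM [d d0 hd] y /closure_norm hy.
have /choice[s hs] : forall n : nat, exists x, M x /\ `|y - A x| < 1 / 2 ^+ n.
  move=> n; have e0 : 0 < 1 / 2 ^+ n :> K by rewrite divr_gt0 ?exprn_gt0.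
  have [_ [x Mx <-] yx] := hy _ e0.
  by exists x.
have ys n : `|y - A (s n)| <= 1 / 2 ^+ n by case: (hs n) => _ /ltW.
have Ms n : M (s n) by case: (hs n).
(* A step of [s] is at most [2 / d / 2 ^+ n], which has to be [rho n / 2]. *)
pose rho n : K := 4 / d / 2 ^+ n.
have [l [sl hl]] : exists l, s @ \oo --> l /\ forall n, `|l - s n| <= rho n.
  apply: halving_cvg => // n; last by rewrite /rho exprSr invfM mulrA.
  rewrite -(ler_pM2l d0); apply: le_trans (hd _ _) _.
    exact: linear_subspaceB.
  rewrite linearB -(subrKA y) addrC -(opprB y); apply: le_trans (ler_normB _ _) _.
  apply: le_trans (lerD (ys _) (ys _)) _.
  have -> : d * (rho n / 2) = 1 / 2 ^+ n + 1 / 2 ^+ n.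
    by rewrite /rho; field; rewrite expf_neq0 ?pnatr_eq0 ?gt_eqF.
  rewrite lerD2l // ler_pM2l // lef_pV2 ?posrE ?exprn_gt0 //.
  by rewrite exprS ler_peMl ?exprn_ge0 // ler1n.
exists l.
  by apply: (closed_cvg _ clM _ _ sl); apply: nearW.
apply/eqP; rewrite eq_sym -subr_eq0 -normr_le0.
apply: (le0_dyadic (D := 1 + C * (4 / d)) hK) => [|n].
  by rewrite addr_ge0 // mulr_ge0 ?divr_ge0 // ltW.
rewrite -(subrKA (A (s n))) mulrDl; apply: le_trans (ler_normD _ _) _.
rewrite lerD // -linearB; apply: le_trans (hC _) _.
by rewrite -mulrA ler_pM2l // distrC.
Qed.

End BoundedBelowBanach.

(** * Complements of the null-space and type I *)

Section TypeI.
Context {K : numFieldType} {X Y : completeNormedModType K}.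
Implicit Types (A : {linear X -> Y}) (M U : set X).

Lemma closed_null_space A : continuous A -> closed (null_space A).
Proof.
move=> cA; apply: preimage_closed => //.
exact: accessible_closed_set1 (hausdorff_accessible (@norm_hausdorff _ _)) _.
Qed.

Lemma linear_subspace_null_space A : linear_subspace (null_space A).
Proof.
apply/linear_subspaceP; split; first exact: linear0.
by move=> a u v /= Au Av; rewrite /null_space /= linearP Au Av scaler0 addr0.
Qed.

Lemma bounded_below_complemented A M :
  continuous A -> linear_subspace M -> closed M -> bounded_below A M ->
  complemented (A @^-1` (A @` M)) (null_space A).
Proof.
move=> cA hM clM bM; split.
  split; first exact: linear_subspace_null_space.
    by move=> x Ax0; exists 0; [exact: linear_subspace0 | rewrite linear0 Ax0].
  by apply: closed_subspaceW; apply: closed_null_space.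
exists M; split.
  by split=> //; [move=> x Mx; exists x | apply: closed_subspaceW].
split.
  apply/seteqP; split=> [x [m Mm Am]|_ [n An0 [m Mm <-]]].
    exists (x - m); first by rewrite /null_space /= linearB Am subrr.
    by exists m => //; rewrite subrK.
  by exists m => //; rewrite linearD An0 add0r.
apply/seteqP; split=> [x [Ax0 Mx]|_ ->].
  exact: bounded_below_eq0 bM Mx Ax0.
by split; [exact: linear0 | exact: linear_subspace0].
Qed.

(** The given [M] need not be closed, so the witness for type I is the image of
    its closure. *)
Lemma isomorphism_type_I A M : real_or_complex K ->
  bounded_near A (nbhs (0 : X)) -> ill_posed A ->
  linear_subspace M -> infinite_dimensional M -> isomorphism_onto_image A M ->
  ill_posed_type_I A.
Proof.
move=> hK hA hill hM infM isoM; split=> //.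
have bM := bounded_below_closure hA (isomorphism_bounded_below hM isoM).
have hcM := linear_subspace_closure hM.
have clM := @closed_closure _ M.
exists (A @` closure M); split.
- by move=> _ [x _ <-]; exists x.
- exact: linear_subspace_image.
- exact: bounded_below_closed_image.
- move=> finAM; apply: infM.
  apply: (finite_dimensional_subset hM (@subset_closure _ M)).
  by apply: (finite_dimensional_inj hcM _ finAM) => x; exact: bounded_below_eq0 bM.
- apply: bounded_below_complemented => //.
  exact: bounded_linear_continuous.
Qed.

(** The subspace is the complement [U] of the null-space in the inverse image of
    the witness [M]: there [A] is injective with image [M], so the preimage of
    controlled norm provided by [open_mapping] is the only one. *)
Lemma type_I_isomorphism A : real_or_complex K ->
  bounded_near A (nbhs (0 : X)) -> ill_posed_type_I A ->
  exists M, [/\ linear_subspace M, infinite_dimensional M &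
    isomorphism_onto_image A M].
Proof.
move=> hK hA [_ [M [MA hM clM infM [_ [U [[hU UM clU] [ZE NU0]]]]]]].
have cA := bounded_linear_continuous hA.
have AU : A @` U = M.
  apply/seteqP; split=> [_ [u /UM ? <-] //|y My]; have [x _ xy] := MA y My.
  have : (A @^-1` M) x by rewrite /= xy.
  rewrite ZE => -[n An0 [u Uu xE]]; exists u => //.
  by rewrite -xy -xE linearD An0 add0r.
(* [U] is closed relative to the inverse image of [M], itself closed in [X]. *)
have {}clU : closed U.
  have [V clV VU] := proj1 (closed_subspaceP _ _) clU.
  rewrite -(setIidl UM) -VU; apply: closedI => //.
  exact: preimage_closed.
exists U; split=> //.
  by move=> finU; apply: infM; rewrite -AU; exact: finite_dimensional_image.
apply: bounded_below_isomorphism => //.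
rewrite -AU in clM.
have [C C0 hC] := open_mapping hK hA hU clU clM.
have C10 : 0 < C + 1 by rewrite ltr_pwDr.
exists (C + 1)^-1 => [|x Ux]; first by rewrite invr_gt0.
have [u [Uu Au uC]] := hC (A x) (ex_intro2 _ _ x Ux erefl).
have ux : x = u.
  apply/eqP; rewrite -subr_eq0; apply/eqP.
  have : (null_space A `&` U) (x - u).
    split; last exact: linear_subspaceB.
    by rewrite /null_space /= linearB Au subrr.
  by rewrite NU0.
rewrite ler_pdivrMl // {1}ux; apply: le_trans uC _.
by rewrite ler_wpM2r // lerDl.
Qed.

End TypeI.

Unset Implicit Arguments.

Theorem proposition8 (K : numFieldType) (hK : real_or_complex K)
  (X Y : completeNormedModType K)
  (hX : infinite_dimensional [set: X]) (hY : infinite_dimensional [set: Y])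
  (A : {linear X -> Y}) (hA : bounded_near A (nbhs (0 : X)))
  (hill : ill_posed A) :
  ill_posed_type_II A <-> strictly_singular A.
Proof.
split=> [[_ nI] M hM infM isoM|ssA].
  by apply: nI; exact: isomorphism_type_I isoM.
split=> // /(type_I_isomorphism hK hA)[M [hM infM isoM]].
exact: ssA hM infM isoM.
Qed.
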